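(* Let $g$ be a value function that is symmetric, monotone, continuous, and satisfies the extended diminishing returns property, and let $u(S)=\mathbb{E}[g(\mathbf X_S)]$ be the corresponding utility function. Suppose the estimates $\hat r_i$ and $\epsilon\in[0,1)$ satisfy the $\epsilon$-accuracy condition described in the context, and let $A$ be the output of Algorithm 1. Then $$u(A)\geq \frac{(1-\epsilon)p}{(1-\epsilon)p+2q}\,u(OPT),\qquad p=1-1/e,\ q=5.307 .$$
   Context: Items $[n]=\{1,\dots,n\}$; item $i$ has a nonnegative random value $X_i\sim P_i$, and $X_1,\dots,X_n$ are independent. A value function is a function $g:\mathbb{R}_+^m\to\mathbb{R}_+$ with $m\ge n$; it is symmetric if invariant under permutations of coordinates. For $\mathbf x\in\mathbb{R}_+^\ell$ with $\ell\le m$ set $g(\mathbf x):=g(\mathbf x,0,\dots,0)$. For $S\subseteq[n]$, $\mathbf X_S$ is the vector with entries $X_i$, $i\in S$, and $u(S):=\mathbb{E}[g(\mathbf X_S)]$. A vector $\mathbf x$ is a subvector of $\mathbf y$ if the entries of $\mathbf x$ appear as a subset of the entries of $\mathbf y$. $g$ is monotone if $g(\mathbf x)\le g(\mathbf y)$ whenever $\mathbf x$ is a subvector of $\mathbf y$; $g$ has the diminishing returns property if $g(\mathbf x,z)-g(\mathbf x)\ge g(\mathbf y,z)-g(\mathbf y)$ for all $z\ge 0$ and all $\mathbf x$ subvector of $\mathbf y$; $g$ has the extended diminishing returns property if it has the diminishing returns property and for every $v\ge0$ in the image of $g$ there is $\mathbf y\in\mathbb{R}_+^{m-1}$ with $g(\mathbf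 y)=v$ and $g(\mathbf x,z)-g(\mathbf x)\ge g(\mathbf y,z)-g(\mathbf y)$ for all $z\ge0$ and all $\mathbf x$ with $g(\mathbf x)\le v$. Items have costs $0<c_i\le B$ and there is a budget $B>0$; $c(S)=\sum_{i\in S}c_i$, and $OPT$ is a set maximizing $u(S)$ subject to $c(S)\le B$. Let $k_i=\lfloor B/c_i\rfloor$ and define the replication test score $r_i=\mathbb{E}[g(X_i^{(1)},\dots,X_i^{(k_i)})]$, where $X_i^{(1)},\dots,X_i^{(k_i)}$ are independent copies of $X_i$. Algorithm 1: given estimates $\hat r_i$ of $r_i$, relabel items so that $\hat r_1\ge\hat r_2\ge\dots\ge\hat r_n$, and let $k\in[n]$ be the index with $c_1+\dots+c_k\le B<c_1+\dots+c_{k+1}$ (assumed to exist). The $\epsilon$-accuracy condition is $r_1,\dots,r_{k+1}\ge(1-\epsilon)\max\{r_i:i\in[n]\setminus[k]\}$. Build $S^*$ starting from $\{1,\dots,k\}$ and, for $i=k+2,\dots,n$ in order, adding $i$ if the total cost stays $\le B$; build $S^{**}$ starting from $\{k+1\}$ and, for $i=1,\dots,k,k+2,\dots,n$ in order, adding $i$ if the total cost stays $\le B$. The output $A$ is whichever of $S^*,S^{**}$ has larger utility.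
   Formalization: g is taken on nonnegative vectors of every length (compatible with zero padding), and is symmetric, monotone, continuous with diminishing returns at all lengths, not just on R_+^m, where the claim fails for huge m; also k_i ≤ m is assumed, so that r_i is defined. *)

(* Defs.v *)
From HB Require Import structures.
From mathcomp Require Import all_boot all_order all_algebra all_fingroup.
From mathcomp Require Import all_classical all_reals all_analysis.

Set Implicit Arguments.
Unset Strict Implicit.
Unset Printing Implicit Defensive.

Import Order.TTheory GRing.Theory Num.Theory.
Import numFieldNormedType.Exports.

Local Open Scope classical_set_scope.
Local Open Scope ring_scope.

Section ValueFunctions.
Context {R : realType}.
Implicit Types (g : seq R -> R) (x y : seq R) (z v : R) (m : nat).

(* A vector of R_+^l is a sequence of size l whose entries are nonnegative.   *)
Definition nonneg_vec x : Prop := {in x, forall a, 0 <= a}.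

(* [g] takes vectors of every length; its restriction to vectors of size [m]  *)
(* is the function R_+^m -> R_+, and shorter vectors are padded with zeros.   *)
(* No upper bound on the length is imposed: g is evaluated at B / c_i copies  *)
(* of an item, and the diminishing returns inequality is meant for            *)
(* concatenations of such vectors with one another.                           *)
Definition value_function g : Prop :=
  (forall x, nonneg_vec x -> 0 <= g x) /\
  (forall x, nonneg_vec x -> g (rcons x 0) = g x).

Definition symmetric_vf g : Prop :=
  forall x y, nonneg_vec x -> perm_eq x y -> g x = g y.

(* Inclusion of the entries as multisets. *)
Definition subvector x y : Prop := exists2 s, perm_eq x s & subseq s y.

Definition monotone_vf g : Prop :=
  forall x y, nonneg_vec y -> subvector x y -> g x <= g y.

Definition continuous_vf g : Prop :=
  forall l : nat,
    {within [set x : 'rV[R]_l | forall j, 0 <= x ord0 j],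
      continuous (fun x : 'rV[R]_l => g [seq x ord0 j | j <- enum 'I_l])}.

Definition diminishing_returns g : Prop :=
  forall x y z, nonneg_vec y -> 0 <= z -> subvector x y ->
    g (rcons y z) - g y <= g (rcons x z) - g x.

(* The sizes are those for which (x, z) and (y, z) are vectors of R_+^m. *)
Definition extended_diminishing_returns m g : Prop :=
  diminishing_returns g /\
  forall v, 0 <= v ->
    (exists x, [/\ size x = m, nonneg_vec x & g x = v]) ->
    exists y, [/\ size y = m.-1, nonneg_vec y, g y = v &
      forall x z, (size x <= m.-1)%N -> nonneg_vec x -> 0 <= z -> g x <= v ->
        g (rcons y z) - g y <= g (rcons x z) - g x].

End ValueFunctions.

Section RandomValues.
Context {R : realType} {d : measure_display} {T : measurableType d}.
Variable P : probability T R.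

Definition independent_RVs (I : finType) (X : I -> {RV P >-> R}) : Prop :=
  forall (J : {set I}) (E : I -> set R), (forall i, measurable (E i)) ->
    P (\bigcap_(i in [set` J]) (X i @^-1` E i)) =
    (\prod_(i in J) P (X i @^-1` E i))%E.

Definition utility (g : seq R -> R) (I : finType) (X : I -> {RV P >-> R})
    (S : {set I}) : \bar R :=
  'E_P[fun t => g [seq X i t | i <- enum S]]%E.

Definition replication_score (g : seq R -> R) (k : nat)
    (Y : 'I_k -> {RV P >-> R}) : \bar R :=
  'E_P[fun t => g [seq Y j t | j <- enum 'I_k]]%E.

End RandomValues.

Definition same_law {R : realType} {d d' : measure_display}
    {T : measurableType d} {T' : measurableType d'}
    (P : probability T R) (P' : probability T' R)
    (X : {RV P >-> R}) (Y : {RV P' >-> R}) : Prop :=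
  forall E : set R, measurable E -> P' (Y @^-1` E) = P (X @^-1` E).

(* Num.truncn is the floor function on nonnegative arguments. *)
Definition replications {R : realType} (B c : R) : nat := Num.truncn (B / c).

Section Costs.
Context {R : realType} {n : nat}.
Variables (c : 'I_n -> R) (B : R).

Definition cost (S : {set 'I_n}) : R := \sum_(i in S) c i.

Definition is_optimal (u : {set 'I_n} -> \bar R) (O : {set 'I_n}) : Prop :=
  cost O <= B /\ forall S : {set 'I_n}, cost S <= B -> (u S <= u O)%E.

Definition greedy_fill (S0 : {set 'I_n}) (l : seq 'I_n) : {set 'I_n} :=
  foldl (fun S i => if cost (i |: S) <= B then i |: S else S) S0 l.

(* [s j] is the item that receives label j + 1. *)
Definition sorting_relabelling (rhat : 'I_n -> R) (s : {perm 'I_n}) : Prop :=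
  forall i j : 'I_n, (i <= j)%N -> rhat (s j) <= rhat (s i).

(* Labels are shifted by one: the items labelled 1, ..., k are the [s j] with *)
(* j < k, and [s k] is the item labelled k + 1.                               *)
Definition is_break_index (s : {perm 'I_n}) (k : 'I_n) : Prop :=
  (0 < k)%N /\
  \sum_(j < n | (j < k)%N) c (s j) <= B < \sum_(j < n | (j <= k)%N) c (s j).

Definition eps_accurate (r : 'I_n -> \bar R) (eps : R) (s : {perm 'I_n}) (k : 'I_n)
    : Prop :=
  forall j : 'I_n, (j <= k)%N ->
    ((1 - eps)%:E * \big[maxe/-oo]_(l < n | (k <= l)%N) r (s l) <= r (s j))%E.

Definition S_star (s : {perm 'I_n}) (k : 'I_n) : {set 'I_n} :=
  greedy_fill [set s j | j : 'I_n & (j < k)%N]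
              [seq s j | j : 'I_n <- enum 'I_n & (k < j)%N].

Definition S_starstar (s : {perm 'I_n}) (k : 'I_n) : {set 'I_n} :=
  greedy_fill [set s k] [seq s j | j : 'I_n <- enum 'I_n & j != k].

Definition alg1_output (u : {set 'I_n} -> \bar R) (s : {perm 'I_n}) (k : 'I_n)
    (A : {set 'I_n}) : Prop :=
  (A = S_star s k /\ (u (S_starstar s k) <= u (S_star s k))%E) \/
  (A = S_starstar s k /\ (u (S_star s k) <= u (S_starstar s k))%E).

End Costs.

Definition p_const {R : realType} : R := 1 - 1 / expR 1.
Definition q_const {R : realType} : R := 5 + 307 / 1000.

(* Main.v *)
Require Import Defs.
From HB Require Import structures.
From mathcomp Require Import all_boot all_order all_algebra all_fingroup.
From mathcomp Require Import all_classical all_reals all_analysis measurable_realfun.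
From mathcomp Require Import ring lra.

Set Implicit Arguments.
Unset Strict Implicit.
Unset Printing Implicit Defensive.

Import Order.TTheory GRing.Theory Num.Theory.
Import numFieldNormedType.Exports.

Local Open Scope classical_set_scope.
Local Open Scope ring_scope.

(* Writing K for the first k items, u OPT <= u (OPT :&: K) + u (OPT :\: K) by
   subadditivity, and u K, u [set s k] are both at most u A, so it suffices to
   compare u (K :|: [set s k]) from below and u (OPT :\: K) from above with
   replication scores.

   Lower bound, cost S >= B and r_i >= r on S: by diminishing returns the marginal
   gain of i over T is at least (r - u T) / k_i, hence
   r - u S <= r * \prod_i (1 - 1 / k_i) <= r / e.

   Upper bound, cost S <= B and r_i <= r on S: take y with g y = v := 2.3 r from
   the extended diminishing returns property and let delta_i := E[g (y, X_i) - v].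
   Then u S <= v + \sum_i delta_i.  Among the k_i copies of X_i, a copy gains at
   least delta_i in expectation whenever the previous ones have value at most v,
   which by Markov has probability at least 1 - r / v; so
   k_i * (1 - r / v) * delta_i <= r.  Finally \sum_i 1 / k_i <= 61 / 36.  If v is
   above the range of g the bound is trivial. *)

(** * Continuity and measurability of value functions on lists *)

Section ValueFunctionLimits.
Context {R : realType} (g : seq R -> R) (g_cont : continuous_vf g).

(** Lists indexed by [s] are identified with row vectors, where convergence is coordinatewise. The
    sign conditions keep everything inside the orthant, to which continuity is relative. *)
Lemma value_function_cvg (U I : Type) (F : set_system U) (FF : Filter F)
    (s : seq I) (f : U -> I -> R) (a : I -> R) :
    (forall u i, 0 <= f u i) -> (forall i, 0 <= a i) ->
    (forall i, f u i @[u --> F] --> a i) ->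
  g [seq f u i | i <- s] @[u --> F] --> g [seq a i | i <- s].
Proof.
move=> f0 a0 fa; set l := size s.
pose M (w : I -> R) : 'rV[R]_l := \row_j w (tnth (in_tuple s) j).
have E w : [seq w i | i <- s] = [seq M w ord0 j | j <- enum 'I_l].
  have Es : [seq tnth (in_tuple s) j | j <- enum 'I_l] = s.
    exact: (map_tnth_enum (in_tuple s)).
  rewrite -[in LHS]Es -map_comp.
  by apply: eq_map => j; rewrite /= mxE.
have /subspace_continuousP/(_ (M a)) h := g_cont (l := l).
rewrite (_ : (fun u => _) =
    (fun x : 'rV[R]_l => g [seq x ord0 j | j <- enum 'I_l]) \o (M \o f)).
  rewrite E; apply: (cvg_comp _ _ _ (h _)); last by move=> j; rewrite mxE.
  move=> B [Q hQ sQ].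
  have H : \forall u \near F,
      forall ij : 'I_1 * 'I_l, Q ij.1 ij.2 (M (f u) ij.1 ij.2).
    apply: filter_forall => -[i j] /=.
    have Qa : nbhs (a (tnth (in_tuple s) j)) (Q i j).
      by have := hQ i j; rewrite mxE.
    have : \forall u \near F, Q i j (f u (tnth (in_tuple s) j)) by exact: fa Qa.
    by apply: filterS => u; rewrite /= mxE.
  apply: filterS H => u Hu; apply: (sQ (M (f u))) => [i j|j].
    exact: (Hu (i, j)).
  by rewrite mxE.
by apply/funext => u /=; rewrite E.
Qed.

(** The vector is scaled by [t] from 0 to 1 and the one-variable intermediate value theorem applies.
    Absolute values keep the argument in the orthant for every real [t]. *)
Lemma value_function_ivt (x : seq R) (v : R) : nonneg_vec x ->
  g (nseq (size x) 0) <= v <= g x ->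
  exists2 y, size y = size x /\ nonneg_vec y & g y = v.
Proof.
move=> x0 vI.
pose f (t : R) := g [seq `|t * a| | a <- x].
have cf : continuous f.
  move=> t; apply: value_function_cvg => // a.
  by apply: cvg_norm; apply: cvgMl; exact: cvg_id.
have f0 : f 0 = g (nseq (size x) 0).
  rewrite /f; congr g; elim: x {x0 vI f cf} => //= a x ->.
  by rewrite mul0r normr0.
have f1 : f 1 = g x.
  rewrite /f; congr g; rewrite -[RHS]map_id; apply/eq_in_map => a ax.
  by rewrite mul1r ger0_norm// x0.
have [|t _ <-] := @IVT R f 0 1 v ler01 (continuous_subspaceT cf).
  move: vI; rewrite f0 f1 => /andP[h1 h2].
  by rewrite ge_min h1 le_max h2 orbT.
exists [seq `|t * a| | a <- x] => //; rewrite size_map; split=> //.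
by move=> _ /mapP[a _ ->].
Qed.

(** [F] is arbitrary: a preimage splits into countably many pieces according to the value at the
    head, and induction handles the tail. *)
Lemma measurable_discrete_fun d (T : measurableType d) (I : Type)
    (s : seq I) (K : I -> T -> nat) (F : seq nat -> R) :
    (forall i q, measurable (K i @^-1` [set q])) ->
  measurable_fun setT (fun t => F [seq K i t | i <- s]).
Proof.
move=> mK; elim: s F => [F|i s IH F]; first exact: (@measurable_cst _ _ T R setT (F [::])).
move=> _ A mA; rewrite setTI.
have -> : (fun t => F [seq K i t | i <- i :: s]) @^-1` A =
    \bigcup_q (K i @^-1` [set q] `&`
      ((fun t => F (q :: [seq K i t | i <- s])) @^-1` A)).
  apply/seteqP; split => [t At|t [q _ [/= <- //]]].
  by exists (K i t).
apply: bigcup_measurable => q _; apply: measurableI => //.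
by rewrite -[X in measurable X]setTI; exact: (IH (fun z => F (q :: z))).
Qed.

Lemma truncn_scaled_cvg (x : R) : 0 <= x ->
  (Num.truncn (x * N.+1%:R))%:R / N.+1%:R @[N --> \oo] --> x.
Proof.
move=> x0; apply/cvgrPdist_lt => e e0; near=> N.
have N0 : (0 : R) < N.+1%:R by rewrite ltr0n.
have /truncn_itv/andP[h1 h2] : 0 <= x * N.+1%:R by rewrite mulr_ge0.
rewrite ger0_norm; last by rewrite subr_ge0 ler_pdivrMr.
have eN : N.+1%:R^-1 < e.
  by near: N; exact: (@near_infty_natSinv_lt R (PosNum e0)).
have {}eN : 1 < e * N.+1%:R by rewrite -ltr_pdivrMr// div1r.
rewrite -(ltr_pM2r N0) mulrBl divfK ?gt_eqF//.
by move: h2 eN; rewrite -natr1; lra.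
Unshelve. all: by end_near. Qed.

(* g is the limit of its values on the grids (N + 1)^-1 * nat, on which only
   countably many arguments occur. *)
Lemma measurable_value_function d (T : measurableType d) (I : Type)
    (s : seq I) (Z : I -> T -> R) :
    (forall i t, 0 <= Z i t) -> (forall i, measurable_fun setT (Z i)) ->
  measurable_fun setT (fun t => g [seq Z i t | i <- s]).
Proof.
move=> Z0 mZ.
pose K N i t := Num.truncn (Z i t * N.+1%:R).
apply: (@measurable_fun_cvg _ _ _ _
    (fun N t => g [seq (K N i t)%:R / N.+1%:R | i <- s])) => [N|t _].
  rewrite (_ : (fun t => _) =
    (fun t => (g \o map (fun q => q%:R / N.+1%:R)) [seq K N i t | i <- s])).
    apply: measurable_discrete_fun => i q.
    rewrite (_ : _ @^-1` _ = Z i @^-1` `[q%:R / N.+1%:R, q.+1%:R / N.+1%:R[).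
      by rewrite -[X in measurable X]setTI; apply: mZ.
    apply/seteqP; split => t /=; rewrite in_itv /=;
        rewrite ler_pdivrMr ?ltr0n// ltr_pdivlMr ?ltr0n//.
      by rewrite /K => <-; apply: truncn_itv; rewrite mulr_ge0.
    by move=> h; apply/truncn_def.
  by apply/funext => t /=; rewrite -map_comp.
apply: (@value_function_cvg nat I \oo _ s (fun N i => (K N i t)%:R / N.+1%:R)
  (fun i => Z i t)) => // i; exact: truncn_scaled_cvg.
Qed.

End ValueFunctionLimits.

Local Notation image_measure :=
  measure_function_pushforward__canonical__measure_function_Measure.

(** * Joint laws determined by their values on boxes *)

Section EqualLaws.
Context {R : realType} (I : finType).

(** A pi-system containing the whole space; as [I] is finite, it generates the product
    sigma-algebra. *)
Definition boxes : set (set (I -> R)) :=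
  [set B | exists2 E : I -> set R, (forall i, measurable (E i)) &
           B = \bigcap_i (fun f => f i) @^-1` E i].

Let V := g_sigma_algebraType boxes.

Lemma setI_closed_boxes : setI_closed boxes.
Proof.
move=> _ _ [E mE ->] [F mF ->]; exists (fun i => E i `&` F i).
  by move=> i; exact: measurableI.
by rewrite -bigcapI.
Qed.

Lemma boxesT : boxes setT.
Proof.
exists (fun=> setT) => //; apply/seteqP; split=> f //=.
Qed.

Lemma measurable_coordinate (i : I) :
  measurable_fun setT (fun f : V => f i : R).
Proof.
move=> _ A mA; rewrite setTI; apply: sub_sigma_algebra.
exists (fun j => if j == i then A else setT) => [j|]; first by case: ifP.
apply/seteqP; split=> [f Af j _ /=|f /(_ i Logic.I)]; last by rewrite /= eqxx.
by case: eqP => [->|].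
Qed.

Section Family.
Context d (T : measurableType d) (Z : I -> T -> R).
Hypothesis mZ : forall i, measurable_fun setT (Z i).

Lemma measurable_bigcap_preimage (E : I -> set R) :
  (forall i, measurable (E i)) -> measurable (\bigcap_i Z i @^-1` E i).
Proof.
move=> mE; apply: fin_bigcap_measurable => // i _.
by rewrite -[X in measurable X]setTI; exact: mZ.
Qed.

Lemma measurable_family : measurable_fun setT (fun t => Z ^~ t : V).
Proof.
apply: (@measurability _ _ T V setT _ boxes erefl) => _ [_ [E mE ->] <-].
by rewrite setTI; exact: measurable_bigcap_preimage.
Qed.

End Family.

(** The two image measures on [V] agree on a pi-system and have finite mass, so they coincide. *)
Lemma eq_box_integral d (T : measurableType d) d' (T' : measurableType d')
    (mu : {measure set T -> \bar R}) (nu : {measure set T' -> \bar R})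
    (Z : I -> T -> R) (W : I -> T' -> R) (h : V -> \bar R) :
    (mu setT < +oo)%E ->
    (forall i, measurable_fun setT (Z i)) ->
    (forall i, measurable_fun setT (W i)) ->
    (forall E : I -> set R, (forall i, measurable (E i)) ->
      mu (\bigcap_i Z i @^-1` E i) = nu (\bigcap_i W i @^-1` E i)) ->
    measurable_fun setT h -> (forall f, 0 <= h f)%E ->
  (\int[mu]_t h (Z ^~ t) = \int[nu]_t h (W ^~ t))%E.
Proof.
move=> fmu mZ mW eqE mh h0.
have pushE d1 (T1 : measurableType d1) (m : {measure set T1 -> \bar R})
    (Y : I -> T1 -> R) (mY : forall i, measurable_fun setT (Y i)) :
    (\int[m]_t h (Y ^~ t) = \int[image_measure m (measurable_family mY)]_f h f)%E.
  by rewrite (ge0_integral_pushforward (measurable_family mY) m).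
rewrite (pushE _ _ mu _ mZ) (pushE _ _ nu _ mW).
apply: eq_measure_integral => A mA _.
apply: (@measure_unique _ _ V boxes (fun=> setT)) => //.
- exact: setI_closed_boxes.
- by move=> _; exact: boxesT.
- by rewrite bigcup_const//; exists 0%N.
- by move=> _ [E mE ->]; exact: eqE.
Qed.

End EqualLaws.

(** * Tonelli's theorem for functions of separated variables *)

Section ProductIntegral.
Context {R : realType} d (T : measurableType d) d' (T' : measurableType d').
Context (P : probability T R) (Q : probability T' R).
Local Open Scope ereal_scope.

Lemma integral_prod_mule (f : T -> \bar R) (h : T' -> \bar R) :
  measurable_fun setT f -> measurable_fun setT h ->
  (forall t, 0 <= f t) -> (forall t, 0 <= h t) ->
  \int[P \x Q]_t (f t.1 * h t.2) = \int[P]_t f t * \int[Q]_t h t.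
Proof.
move=> mf mh f0 h0; rewrite fubini_tonelli1; last 2 first.
- by apply: emeasurable_funM; apply: measurableT_comp.
- by move=> t; rewrite mule_ge0.
rewrite -ge0_integralZr//; last exact: integral_ge0.
by apply: eq_integral => t _; rewrite /fubini_F/= ge0_integralZl.
Qed.

Lemma integral_prod_fst (f : T -> \bar R) :
  measurable_fun setT f -> (forall t, 0 <= f t) ->
  \int[P \x Q]_t f t.1 = \int[P]_t f t.
Proof.
move=> mf f0; transitivity (\int[P \x Q]_t (f t.1 * cst 1 t.2)).
  by apply: eq_integral => t _; rewrite mule1.
rewrite integral_prod_mule// integral_cst// mul1e.
by rewrite [X in _ * X](@probability_setT _ _ _ Q) mule1.
Qed.

Lemma integral_prod_snd (h : T' -> \bar R) :
  measurable_fun setT h -> (forall t, 0 <= h t) ->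
  \int[P \x Q]_t h t.2 = \int[Q]_t h t.
Proof.
move=> mh h0; transitivity (\int[P \x Q]_t (cst 1 t.1 * h t.2)).
  by apply: eq_integral => t _; rewrite mul1e.
rewrite integral_prod_mule// integral_cst// mul1e.
by rewrite [X in X * _](@probability_setT _ _ _ P) mul1e.
Qed.

End ProductIntegral.

(** * Replacing one variable by a copy on another factor *)

Section ExpectedValue.
Context {R : realType} (g : seq R -> R).
Hypothesis g_value : value_function g.
Hypothesis g_cont : continuous_vf g.

Lemma nonneg_vec_map (I : Type) (s : seq I) (f : I -> R) :
  (forall i, 0 <= f i) -> nonneg_vec [seq f i | i <- s].
Proof.
by move=> f0; elim: s => [|i s IH] // a; rewrite inE => /predU1P[->|/IH].
Qed.

Lemma measurable_value_function_cat d (T : measurableType d) (I J : Type)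
    (s : seq I) (l : seq J) (Z : I -> T -> R) (W : J -> T -> R) :
    (forall i t, 0 <= Z i t) -> (forall i, measurable_fun setT (Z i)) ->
    (forall i t, 0 <= W i t) -> (forall i, measurable_fun setT (W i)) ->
  measurable_fun setT (fun t => g ([seq Z i t | i <- s] ++ [seq W j t | j <- l])).
Proof.
move=> Z0 mZ W0 mW.
pose ZW (ij : I + J) := match ij with inl i => Z i | inr j => W j end.
rewrite (_ : (fun t => _) =
    (fun t => g [seq ZW ij t | ij <- map inl s ++ map inr l])).
  by apply: (measurable_value_function g_cont) => -[].
by apply/funext => t; rewrite map_cat -!map_comp.
Qed.

Section Resampling.
Context d (T : measurableType d) d' (T' : measurableType d').
Context (P : probability T R) (Q : probability T' R) (I : finType).
Context (Z : I -> {RV P >-> R}) (i0 : I) (V : {RV Q >-> R}).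
Hypothesis Z_ge0 : forall i t, 0 <= Z i t.
Hypothesis V_ge0 : forall t, 0 <= V t.
Hypothesis Z_indep : independent_RVs Z.
Hypothesis V_law : same_law (Z i0) V.

(** Coordinate [i0] is read from the second factor, all others from the first. *)
Let W (i : I) (t : T * T') : R := if i == i0 then V t.2 else Z i t.1.

Let mW i : measurable_fun setT (W i).
Proof. by rewrite /W; case: eqP => _; apply: measurableT_comp. Qed.

(** Independence splits off the factor of [i0], equality of laws moves it to [Q], and a box for [W]
    is a measurable rectangle. *)
Let W_box (E : I -> set R) : (forall i, measurable (E i)) ->
  P (\bigcap_i Z i @^-1` E i) = (P \x Q)%E (\bigcap_i W i @^-1` E i).
Proof.
move=> mE.
have ZT : \bigcap_i Z i @^-1` E i =
    \bigcap_(i in [set` [set: I]%SET]) Z i @^-1` E i.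
  by apply/seteqP; split=> t h i _; apply: (h i); rewrite /= ?finset.in_setT.
have WT : \bigcap_i W i @^-1` E i =
    (\bigcap_(i in [set` [set~ i0]%SET]) Z i @^-1` E i) `*` (V @^-1` E i0).
  apply/seteqP; split=> [t Wt|t [Zt Vt] i _] /=.
    split=> [i|]; last by have := Wt i0 Logic.I; rewrite /= /W eqxx.
    by rewrite /= finset.in_setC1 => ii0; have := Wt i Logic.I; rewrite /= /W (negbTE ii0).
  by rewrite /W; case: eqP => [-> //|/eqP ii0]; apply: (Zt i); rewrite /= finset.in_setC1.
rewrite ZT WT.
transitivity (P (\bigcap_(i in [set` [set~ i0]%SET]) Z i @^-1` E i) *
    Q (V @^-1` E i0))%E.
  rewrite !Z_indep// V_law// [RHS]muleC (bigD1 i0) ?finset.in_setT//=.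
  by congr (_ * _)%E; apply: eq_bigl => i; rewrite finset.in_setT finset.in_setC1.
apply/esym/product_measure1E.
  apply: fin_bigcap_measurable => // i _.
  by rewrite -[X in measurable X]setTI; exact: measurable_funP.
by rewrite -[X in measurable X]setTI; exact: measurable_funP.
Qed.

(* Z i0 may be replaced by a variable V with the same law living on another
   factor of a product space. *)
Lemma integral_resample (s : seq I) : i0 \notin s ->
  (\int[P \x Q]_t (g (rcons [seq Z i t.1 | i <- s] (V t.2)))%:E =
   \int[P]_t (g [seq Z i t | i <- rcons s i0])%:E)%E.
Proof.
move=> i0s.
(* [h] has to be measurable and nonnegative on all of [I -> R], while [g] is controlled only on the
   orthant; hence the absolute values. *)
pose h (f : g_sigma_algebraType (@boxes R I)) :=
  (g [seq `|f i| | i <- rcons s i0])%:E.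
have W0 i t : 0 <= W i t by rewrite /W; case: eqP.
transitivity (\int[P \x Q]_t h (W ^~ t))%E.
  apply: eq_integral => t _; rewrite /h map_rcons; congr ((g (rcons _ _))%:E).
    apply/eq_in_map => i si; rewrite ger0_norm// /W ifN//.
    by apply: contraNN i0s => /eqP <-.
  by rewrite ger0_norm// /W eqxx.
rewrite -(@eq_box_integral R I _ T _ _ P (P \x Q)%E (fun i => Z i : T -> R) W).
- by apply: eq_integral => t _; rewrite /h; do 2 congr (_ _); apply: eq_map => i;
    rewrite ger0_norm.
- by rewrite [X in (X < _)%E](@probability_setT _ _ _ P) ltry.
- by [].
- exact: mW.
- exact: W_box.
- apply/measurable_EFinP.
  apply: (@measurable_value_function _ g g_cont _
    (g_sigma_algebraType (@boxes R I)) I _ (fun i f => `|f i|)) => // i.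
  by apply: measurableT_comp => //; exact: measurable_coordinate.
- by move=> f; rewrite lee_fin; apply: g_value.1; apply: nonneg_vec_map.
Qed.

End Resampling.

End ExpectedValue.

(** * Diminishing returns, pointwise and in expectation *)

Section DiminishingReturns.
Context {R : realType} (g : seq R -> R).
Hypothesis g_value : value_function g.
Hypothesis g_mono : monotone_vf g.
Hypothesis g_cont : continuous_vf g.
Hypothesis g_dr : diminishing_returns g.

Lemma nonneg_vec_cat (x y : seq R) :
  nonneg_vec x -> nonneg_vec y -> nonneg_vec (x ++ y).
Proof. by move=> x0 y0 a; rewrite mem_cat => /orP[/x0|/y0]. Qed.

Lemma nonneg_vec_rcons (x : seq R) (z : R) :
  nonneg_vec x -> 0 <= z -> nonneg_vec (rcons x z).
Proof. by move=> x0 z0 a; rewrite mem_rcons inE => /predU1P[->|/x0]. Qed.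

Lemma subvector_subseq (x y : seq R) : subseq x y -> subvector x y.
Proof. by exists x. Qed.

(** Entries are appended one by one; [x] is a prefix of the current vector, so each gains at most
    what it gains on [x] alone. *)
Lemma value_cat_sub_le (x l : seq R) : nonneg_vec x -> nonneg_vec l ->
  g (x ++ l) - g x <= \sum_(z <- l) (g (rcons x z) - g x).
Proof.
move=> x0; elim/last_ind: l => [|l z IH l0].
  by rewrite cats0 subrr big_nil.
have {}l0 : nonneg_vec l /\ 0 <= z.
  by split=> [a al|]; apply: l0; rewrite mem_rcons inE ?al ?orbT ?eqxx.
case: l0 => l0 z0; rewrite -rcons_cat big_rcons /=.
have := g_dr (nonneg_vec_cat x0 l0) z0 (subvector_subseq (prefix_subseq x l)).
by have := IH l0; lra.
Qed.

(** Here gains over [x ++ y] are compared with gains over the suffix [y]; the base case is [0 <= g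
    [::]]. *)
Lemma value_cat_le (x y : seq R) : nonneg_vec x -> nonneg_vec y ->
  g (x ++ y) <= g x + g y.
Proof.
move=> x0; elim/last_ind: y => [|y z IH y0].
  by move=> y0; rewrite cats0 lerDl g_value.1.
have {}y0 : nonneg_vec y /\ 0 <= z.
  by split=> [a ay|]; apply: y0; rewrite mem_rcons inE ?ay ?orbT ?eqxx.
case: y0 => y0 z0; rewrite -rcons_cat.
have := g_dr (nonneg_vec_cat x0 y0) z0 (subvector_subseq (suffix_subseq x y)).
by have := IH y0; lra.
Qed.

Lemma value_rcons_ge (x : seq R) (z : R) : nonneg_vec x -> 0 <= z ->
  g x <= g (rcons x z).
Proof.
move=> x0 z0; apply: g_mono; first exact: nonneg_vec_rcons.
exact/subvector_subseq/subseq_rcons.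
Qed.

Lemma sume_const_seq (J : Type) (l : seq J) (a : \bar R) : (0 <= a)%E ->
  (\sum_(j <- l) a = (size l)%:R%:E * a)%E.
Proof.
move=> a0; elim: l => [|j l IH]; first by rewrite big_nil mul0e.
by rewrite big_cons IH /= -natr1 EFinD ge0_muleDl ?lee_fin// mul1e addeC.
Qed.

Section Replication.
Context d (T : measurableType d) d' (T' : measurableType d').
Context (P : probability T R) (Q : probability T' R) (I J : finType).
Context (Z : I -> {RV P >-> R}) (i0 : I) (Y : J -> {RV Q >-> R}).
Hypothesis Z_ge0 : forall i t, 0 <= Z i t.
Hypothesis Y_ge0 : forall j t, 0 <= Y j t.
Hypothesis Z_indep : independent_RVs Z.
Hypothesis Y_law : forall j, same_law (Z i0) (Y j).

Local Open Scope ereal_scope.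

(* Fresh copies of Z i0 are added one by one to Z_s; by diminishing returns each
   gains at most what Z i0 gains alone. *)
Lemma replication_step (s : seq I) (l : seq J) : i0 \notin s ->
  \int[Q]_t (g [seq Y j t | j <- l])%:E +
    (size l)%:R%:E * \int[P]_t (g [seq Z i t | i <- s])%:E <=
  \int[P]_t (g [seq Z i t | i <- s])%:E +
    (size l)%:R%:E * \int[P]_t (g [seq Z i t | i <- rcons s i0])%:E.
Proof.
move=> i0s.
have nZ t : nonneg_vec [seq Z i t | i <- s] by exact: nonneg_vec_map.
have nY t : nonneg_vec [seq Y j t | j <- l] by exact: nonneg_vec_map.
have mZ : measurable_fun setT (fun t => (g [seq Z i t | i <- s])%:E).
  by apply/measurable_EFinP; exact: measurable_value_function.
have mY : measurable_fun setT (fun t => (g [seq Y j t | j <- l])%:E).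
  by apply/measurable_EFinP; exact: measurable_value_function.
have mZ1 : measurable_fun setT (fun t : T * T' => (g [seq Z i t.1 | i <- s])%:E).
  by apply: (measurableT_comp mZ).
have mY2 : measurable_fun setT (fun t : T * T' => (g [seq Y j t.2 | j <- l])%:E).
  by apply: (measurableT_comp mY).
have mZY j : measurable_fun setT
    (fun t : T * T' => (g (rcons [seq Z i t.1 | i <- s] (Y j t.2)))%:E).
  apply/measurable_EFinP.
  under eq_fun do rewrite -cats1.
  apply: (@measurable_value_function_cat _ g g_cont _ _ _ _ s [:: j]
    (fun i t => Z i t.1) (fun j t => Y j t.2)) => // i; exact: measurableT_comp.
have g0 x : nonneg_vec x -> 0 <= (g x)%:E by rewrite lee_fin; exact: g_value.1.
rewrite -!sume_const_seq; try by apply: integral_ge0 => t _; apply/g0/nonneg_vec_map.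
(* Both sides become integrals over the product space, where the inequality holds pointwise. It is
   kept free of subtraction because expectations may be infinite. *)
have -> : \int[Q]_t (g [seq Y j t | j <- l])%:E +
    \sum_(j <- l) \int[P]_t (g [seq Z i t | i <- s])%:E =
    \int[P \x Q]_t ((g [seq Y j t.2 | j <- l])%:E +
      \sum_(j <- l) (g [seq Z i t.1 | i <- s])%:E).
  rewrite ge0_integralD//; first last.
  - exact: emeasurable_sum.
  - by move=> t _; apply: sume_ge0 => j _; exact: g0.
  - by move=> t _; exact: g0.
  rewrite ge0_integral_sum//; last by move=> j t _; exact: g0.
  rewrite (integral_prod_snd P Q mY) => [|t]; last exact: g0.
  by rewrite (integral_prod_fst P Q mZ) => [|t]; last exact: g0.
have -> : \int[P]_t (g [seq Z i t | i <- s])%:E +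
    \sum_(j <- l) \int[P]_t (g [seq Z i t | i <- rcons s i0])%:E =
    \int[P \x Q]_t ((g [seq Z i t.1 | i <- s])%:E +
      \sum_(j <- l) (g (rcons [seq Z i t.1 | i <- s] (Y j t.2)))%:E).
  rewrite ge0_integralD//; first last.
  - exact: emeasurable_sum.
  - by move=> t _; apply: sume_ge0 => j _; apply: g0; exact: nonneg_vec_rcons.
  - by move=> t _; exact: g0.
  rewrite ge0_integral_sum//; last first.
    by move=> j t _; apply: g0; exact: nonneg_vec_rcons.
  rewrite (integral_prod_fst P Q mZ) => [|t]; last exact: g0.
  congr (_ + _); apply: eq_bigr => j _.
  by rewrite (integral_resample g_value g_cont Z_ge0 (Y_ge0 j) Z_indep (Y_law j) i0s).
apply: ge0_le_integral => //.
- by move=> t _; rewrite adde_ge0 ?sume_ge0// => *; exact: g0.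
- by apply: emeasurable_funD => //; exact: emeasurable_sum.
- by apply: emeasurable_funD => //; exact: emeasurable_sum.
move=> t _; rewrite !sumEFin -!EFinD lee_fin.
have := value_cat_sub_le (nZ t.1) (nY t.2).
rewrite big_map sumrB.
have : (g [seq Y j t.2 | j <- l] <=
    g ([seq Z i t.1 | i <- s] ++ [seq Y j t.2 | j <- l]))%R.
  apply: g_mono; first exact: nonneg_vec_cat.
  exact/subvector_subseq/suffix_subseq.
by lra.
Qed.

End Replication.

Section SaturatedGain.
Context d (T : measurableType d) d' (T' : measurableType d').
Context (P : probability T R) (Q : probability T' R) (J : finType).
Context (Y : J -> {RV Q >-> R}) (X : {RV P >-> R}).
Hypothesis Y_ge0 : forall j t, 0 <= Y j t.
Hypothesis X_ge0 : forall t, 0 <= X t.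
Hypothesis Y_indep : independent_RVs Y.
Hypothesis X_law : forall j, same_law (Y j) X.
Variables (y : seq R) (v r : R) (l : seq J).
Hypothesis y_ge0 : nonneg_vec y.
Hypothesis r_lt_v : 0 <= r < v.
Hypothesis l_uniq : uniq l.
Hypothesis y_worst : forall x z, (size x < size l)%N -> nonneg_vec x ->
  0 <= z -> g x <= v -> g (rcons y z) - g y <= g (rcons x z) - g x.

Local Open Scope ereal_scope.

Let gain := \int[P]_t (g (rcons y (X t)) - g y)%:E.

Lemma measurable_gain (Z : {RV P >-> R}) : (forall t, 0 <= Z t)%R ->
  measurable_fun setT (fun t => (g (rcons y (Z t)) - g y)%:E).
Proof.
move=> Z0; apply/measurable_EFinP; apply: measurable_funB => //.
under eq_fun do rewrite -cats1.
(* The entries of [y] are treated as constant random variables; the absolute values make them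
   nonnegative at every index. *)
rewrite (_ : (fun t => _) =
  fun t => g ([seq `|a|%R | a <- y] ++ [seq Z t | _ <- [:: tt]])).
  by apply: (@measurable_value_function_cat _ g g_cont _ _ _ _ y [:: tt]
    (fun a _ => `|a|%R) (fun _ => Z)).
apply/funext => t; congr (g (_ ++ _)); rewrite -[LHS]map_id.
by apply/eq_in_map => a /y_ge0 a0; rewrite ger0_norm.
Qed.

Lemma measurable_unsaturated (s : seq J) :
  measurable [set t | (g [seq Y i t | i <- s] <= v)%R].
Proof.
rewrite (_ : [set t | _] = (fun t => g [seq Y i t | i <- s]) @^-1` `]-oo, v]).
  by rewrite -[X in measurable X]setTI; apply: measurable_value_function.
by apply/seteqP; split=> t; rewrite /= in_itv.
Qed.

(* As long as the copies drawn so far have value at most v, a further copy gains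
   at least what it gains on top of y. *)
Lemma saturated_gain_step (s : seq J) (j : J) : j \notin s ->
    (size s < size l)%N ->
  \int[Q]_t (g [seq Y i t | i <- s])%:E +
    Q [set t | (g [seq Y i t | i <- s] <= v)%R] * gain <=
  \int[Q]_t (g [seq Y i t | i <- rcons s j])%:E.
Proof.
move=> js sl.
set A := [set t | _].
have nY t : nonneg_vec [seq Y i t | i <- s] by exact: nonneg_vec_map.
have g0 x : nonneg_vec x -> 0 <= (g x)%:E by rewrite lee_fin; exact: g_value.1.
have mY : measurable_fun setT (fun t => (g [seq Y j t | j <- s])%:E).
  by apply/measurable_EFinP; exact: measurable_value_function.
have mA : measurable A by exact: measurable_unsaturated.
have D0 t : 0 <= (g (rcons y (X t)) - g y)%:E.
  by rewrite lee_fin subr_ge0 value_rcons_ge.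
have mD := measurable_gain X_ge0.
have mI : measurable_fun setT (fun t => (\1_A t : R)%:E).
  by apply/measurable_EFinP; exact: measurable_indic.
have I0 t : 0 <= (\1_A t : R)%:E by rewrite lee_fin.
have mID : measurable_fun setT (fun t : T' * T =>
    (\1_A t.1 : R)%:E * (g (rcons y (X t.2)) - g y)%:E).
  apply: emeasurable_funM; first exact: (measurableT_comp mI).
  exact: (measurableT_comp mD).
(* The new copy becomes [X] on an independent factor, so the indicator of [A] and the gain over [y]
   integrate to a product. *)
rewrite -(integral_resample g_value g_cont Y_ge0 X_ge0 Y_indep (X_law j) js).
rewrite -(setIT A) -integral_indic// /gain -integral_prod_mule//.
rewrite -(integral_prod_fst Q P mY) => [|t]; last exact: g0.
have mY1 : measurable_fun setT (fun t : T' * T => (g [seq Y j t.1 | j <- s])%:E).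
  exact: (measurableT_comp mY).
rewrite -ge0_integralD//; first last.
- by move=> t _; rewrite mule_ge0.
- by move=> t _; exact: g0.
apply: ge0_le_integral => //.
- by move=> t _; rewrite adde_ge0 ?mule_ge0//; exact: g0.
- exact: emeasurable_funD.
- apply/measurable_EFinP; under eq_fun do rewrite -cats1.
  apply: (@measurable_value_function_cat _ g g_cont _ _ _ _ s [:: tt]
    (fun i t => Y i t.1) (fun _ t => X t.2)) => // i; exact: measurableT_comp.
move=> t _; rewrite -EFinM -EFinD lee_fin indicE.
(* On [A] the gain over [y] is a lower bound by [y_worst]; off [A] monotonicity suffices. *)
case: (boolP (t.1 \in A)) => [/set_mem At|_].
  rewrite mul1r -lerBrDl y_worst// size_map//.
by rewrite mul0r addr0 value_rcons_ge.
Qed.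

(* Markov's inequality *)
Lemma saturation_probability (s : seq J) :
    \int[Q]_t (g [seq Y i t | i <- s])%:E <= r%:E ->
  (1 - r / v)%:E <= Q [set t | (g [seq Y i t | i <- s] <= v)%R].
Proof.
move=> sr; have /andP[r0 rv] := r_lt_v.
have v0 : (0 < v)%R by exact: le_lt_trans rv.
set A := [set t | _].
have mA : measurable A by exact: measurable_unsaturated.
have : v%:E * Q (~` A) <= r%:E.
  apply: le_trans sr.
  rewrite -[X in Q X]setIT -integral_indic//; last exact: measurableC.
  have mI : measurable_fun setT (fun t => (\1_(~` A) t : R)%:E).
    by apply/measurable_EFinP/measurable_indic; exact: measurableC.
  have I0 t : setT t -> 0 <= (\1_(~` A) t : R)%:E by rewrite lee_fin.
  rewrite -(ge0_integralZl_EFin Q measurableT I0 mI (ltW v0)).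
  apply: ge0_le_integral => //.
  - by move=> t _; rewrite mule_ge0 ?lee_fin// ltW.
  - by apply: emeasurable_funM => //; exact: measurable_cst.
  - by apply/measurable_EFinP; exact: measurable_value_function.
  move=> t _; rewrite -EFinM lee_fin indicE.
  case: (boolP (t \in ~` A)) => [/set_mem/= /negP|_].
    by rewrite -ltNge mulr1 => /ltW.
  by rewrite mulr0 g_value.1//; exact: nonneg_vec_map.
rewrite probability_setC//.
have /fineK <- : Q A \is a fin_num by exact: fin_num_measure.
rewrite -EFinB -EFinM !lee_fin => h.
by rewrite lerBlDr -lerBlDl ler_pdivlMr// mulrC.
Qed.

(** Copies are added one at a time. Every prefix of [l] has expected value at most that of [l],
    hence at most [r], so the probability bound [1 - r / v] is available at each step. *)
Lemma saturated_gain_le :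
    \int[Q]_t (g [seq Y i t | i <- l])%:E <= r%:E ->
  ((size l)%:R * (1 - r / v))%:E * gain <= r%:E.
Proof.
move=> lr.
have gain0 : 0 <= gain.
  by apply: integral_ge0 => t _; rewrite lee_fin subr_ge0 value_rcons_ge.
have p0 : (0 <= 1 - r / v)%R.
  by case/andP: r_lt_v => r0 rv; rewrite subr_ge0 ler_pdivrMr ?mul1r ?ltW// (le_lt_trans r0).
have mono (n : nat) : \int[Q]_t (g [seq Y i t | i <- take n l])%:E <=
    \int[Q]_t (g [seq Y i t | i <- l])%:E.
  apply: ge0_le_integral => //.
  - by move=> t _; rewrite lee_fin; apply/g_value.1/nonneg_vec_map.
  - by apply/measurable_EFinP; exact: measurable_value_function.
  - by apply/measurable_EFinP; exact: measurable_value_function.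
  move=> t _; rewrite lee_fin; apply: g_mono; first exact: nonneg_vec_map.
  exact/subvector_subseq/map_subseq/take_subseq.
suff H (n : nat) : (n <= size l)%N -> (n%:R * (1 - r / v))%:E * gain <=
    \int[Q]_t (g [seq Y i t | i <- take n l])%:E.
  by apply: le_trans lr; rewrite -[X in _ <= \int[_]_t (g [seq _ | _ <- X])%:E]take_size; exact: H.
elim: n => [_|n IH nl].
  rewrite mul0r mul0e; apply: integral_ge0 => t _.
  by rewrite lee_fin; apply/g_value.1/nonneg_vec_map.
have [j0 _] : {j0 | j0 \in l} by case: (l) nl => // j0 l' _; exists j0; rewrite mem_head.
rewrite (take_nth j0)//.
have := take_uniq n.+1 l_uniq; rewrite (take_nth j0)// rcons_uniq => /andP[js _].
apply: le_trans (saturated_gain_step js _); last by rewrite size_take nl.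
rewrite -natr1 mulrDl mul1r EFinD ge0_muleDl ?lee_fin ?mulr_ge0//.
apply: leeD; first exact/IH/ltnW.
apply: lee_wpmul2r => //; apply: saturation_probability.
exact: le_trans lr.
Qed.

End SaturatedGain.

End DiminishingReturns.

(** * Arithmetic of the replication counts *)

Section InverseReplications.
Context {R : realType} (I : eqType) (w : I -> R) (k : I -> nat).
Hypothesis w_gt0 : forall i, 0 < w i.
Hypothesis k_gt0 : forall i, (0 < k i)%N.
Hypothesis wk_gt1 : forall i, 1 < (k i).+1%:R * w i.

(** From [1 < (k + 1) w] follows [1 / k <= (1 + 1 / k) w], and [1 + 1 / k] decreases in [k]. *)
Lemma inv_replications_le (a : nat) (s : seq I) : (0 < a)%N ->
    {in s, forall i, (a <= k i)%N} ->
  \sum_(i <- s) (k i)%:R^-1 <= (a.+1%:R : R) / a%:R * \sum_(i <- s) w i.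
Proof.
move=> a0 ak; rewrite mulr_sumr big_seq [X in _ <= X]big_seq.
apply: ler_sum => i /ak aki.
have a0' : (0 : R) < a%:R by rewrite ltr0n.
have k0' : (0 : R) < (k i)%:R by rewrite ltr0n.
have aki' : (a%:R : R) <= (k i)%:R by rewrite ler_nat.
apply: (@le_trans _ _ ((k i).+1%:R / (k i)%:R * w i)).
  by rewrite mulrAC -[X in X <= _]mul1r ler_pM2r ?invr_gt0// ltW.
apply: ler_wpM2r; first exact: ltW.
rewrite ler_pdivrMr// mulrAC ler_pdivlMr// -!natr1; nra.
Qed.

Lemma term_le_sum (s : seq I) (i : I) : i \in s -> w i <= \sum_(j <- s) w j.
Proof.
move=> si; rewrite (big_rem i)//= lerDl.
by apply: sumr_ge0 => j _; exact: ltW.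
Qed.

(* At most one item has k = 1 and then at most one has k = 2, after which the
   remaining weight is below 1/6: this gives 1 + 1/2 + (7/6) (1/6) = 61/36. *)
Lemma sum_inv_replications_le (s : seq I) : \sum_(i <- s) w i <= 1 ->
  \sum_(i <- s) (k i)%:R^-1 <= (61 / 36 : R).
Proof.
move=> w1.
have wk i n : (k i <= n)%N -> 1 < n.+1%:R * w i.
  move=> kn; apply: lt_le_trans (wk_gt1 i) _.
  by rewrite ler_pM2r// ler_nat.
have [/hasP[i si /eqP ki]|/hasPn k1] := boolP (has (fun i => k i == 1%N) s);
    last first.
  (* All counts are at least 2: the sum is at most 3/2. *)
  have := @inv_replications_le 2 s isT.
  have h : {in s, forall i, (2 <= k i)%N}.
    by move=> i /k1; have := k_gt0 i; case: (k i) => [|[]].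
  by move=> /(_ h); lra.
have := wk i 1%N; rewrite ki => /(_ isT) wi.
move: w1; rewrite !(big_rem i si) /= ki => w1.
set s1 := rem i s in w1 *.
have [/hasP[j sj /eqP kj]|/hasPn k2] := boolP (has (fun i => k i == 2%N) s1);
    last first.
  (* The item [i] leaves weight below 1/2, which excludes a second count 1; the sum is at most 1 +
     (4/3) (1/2) = 5/3. *)
  have := @inv_replications_le 3 s1 isT.
  have h : {in s1, forall j, (3 <= k j)%N}.
    move=> j sj; have := k2 _ sj.
    have : ~~ (k j <= 1)%N.
      by apply/negP => /wk; have := term_le_sum sj; lra.
    by case: (k j) => [|[|[]]].
  by move=> /(_ h); lra.
have := wk j 2%N; rewrite kj => /(_ isT) wj.
move: w1; rewrite !(big_rem j sj) /= kj => w1.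
(* A count of at most 5 would need weight above 1/6, more than what remains. *)
have := @inv_replications_le 6 (rem j s1) isT.
have h : {in rem j s1, forall l, (6 <= k l)%N}.
  move=> l sl; rewrite leqNgt ltnS; apply/negP => /wk.
  by have := term_le_sum sl; lra.
by move=> /(_ h); lra.
Qed.

End InverseReplications.

Section Replications.
Context {R : realType} (B c : R).
Hypothesis c_bounds : 0 < c <= B.

Lemma replications_gt0 : (0 < replications B c)%N.
Proof. by case/andP: c_bounds => c0 cB; rewrite truncn_gt0 ler_pdivlMr// mul1r. Qed.

Lemma replications_itv :
  (replications B c)%:R * c <= B < (replications B c).+1%:R * c.
Proof.
case/andP: c_bounds => c0 cB.
have /truncn_itv : 0 <= B / c by rewrite divr_ge0// ltW// (lt_le_trans c0).
by rewrite ler_pdivlMr// ltr_pdivrMr.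
Qed.

End Replications.

(** Factor by factor [1 - x <= exp (- x)]; the bound [x i <= 1] keeps the factors nonnegative, so
    the inequalities multiply. *)
Lemma prod_one_sub_le_expR {R : realType} (I : Type) (s : seq I) (x : I -> R) :
  (forall i, x i <= 1) ->
  \prod_(i <- s) (1 - x i) <= expR (- \sum_(i <- s) x i).
Proof.
move=> x1; rewrite -sumrN expR_sum; apply: ler_prod => i _.
by rewrite subr_ge0 x1/= expR_ge1Dx.
Qed.

(** * Bounds on the utility of sets of items *)

Section Items.
Context {R : realType} (n m : nat) (g : seq R -> R).
Hypothesis g_value : value_function g.
Hypothesis g_sym : symmetric_vf g.
Hypothesis g_mono : monotone_vf g.
Hypothesis g_cont : continuous_vf g.
Hypothesis g_dr : diminishing_returns g.
Hypothesis g_edr : extended_diminishing_returns m g.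
Context (B : R) (c : 'I_n -> R).
Hypothesis B_gt0 : 0 < B.
Hypothesis c_bounds : forall i, 0 < c i <= B.
Hypothesis le_nm : (n <= m)%N.
Hypothesis le_km : forall i, (replications B (c i) <= m)%N.
Context d (T : measurableType d) (P : probability T R) (X : 'I_n -> {RV P >-> R}).
Hypothesis X_ge0 : forall i t, 0 <= X i t.
Hypothesis X_indep : independent_RVs X.
Context d' (T' : measurableType d') (P' : probability T' R).
Context (Y : forall i : 'I_n, 'I_(replications B (c i)) -> {RV P' >-> R}).
Hypothesis Y_ge0 : forall i j t, 0 <= @Y i j t.
Hypothesis Y_law : forall i j, same_law (X i) (@Y i j).
Hypothesis Y_indep : forall i, independent_RVs (@Y i).

Let k i := replications B (c i).

(** Lists carry the inductions, which append one item at a time; [utility_perm] passes to sets. *)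
Local Notation u s := (\int[P]_t (g [seq X i t | i <- s])%:E)%E.

Let k_gt0 i : (0 < k i)%N.
Proof. exact: replications_gt0. Qed.

Lemma expected_value_ge0 (s : seq 'I_n) : (0 <= u s)%E.
Proof.
by apply: integral_ge0 => t _; rewrite lee_fin; apply/g_value.1/nonneg_vec_map.
Qed.

Lemma measurable_value_X (s : seq 'I_n) :
  measurable_fun setT (fun t => (g [seq X i t | i <- s])%:E).
Proof. by apply/measurable_EFinP; exact: measurable_value_function. Qed.

Lemma expected_value_subseq (s1 s2 : seq 'I_n) : subseq s1 s2 -> (u s1 <= u s2)%E.
Proof.
move=> s12; apply: ge0_le_integral => //.
- by move=> t _; rewrite lee_fin; apply/g_value.1/nonneg_vec_map.
- exact: measurable_value_X.
- exact: measurable_value_X.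
move=> t _; rewrite lee_fin; apply: g_mono; first exact: nonneg_vec_map.
exact/subvector_subseq/map_subseq.
Qed.

Lemma expected_value_cat (s1 s2 : seq 'I_n) : (u (s1 ++ s2) <= u s1 + u s2)%E.
Proof.
have g0 s t : (0 <= (g [seq X i t | i <- s])%:E)%E.
  by rewrite lee_fin; apply/g_value.1/nonneg_vec_map.
rewrite -ge0_integralD//; try exact: measurable_value_X.
apply: ge0_le_integral => //.
- exact: measurable_value_X.
- by apply: emeasurable_funD; exact: measurable_value_X.
move=> t _; rewrite -EFinD lee_fin map_cat.
by apply: value_cat_le => //; exact: nonneg_vec_map.
Qed.

(** Appending [i] multiplies the deficit [r - u s] by at most [1 - 1 / k i], by [replication_step]
    with [k i] copies. *)
Lemma expected_value_lower (s : seq 'I_n) (r : R) : uniq s -> 0 <= r ->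
    {in s, forall i, (r%:E <= replication_score g (@Y i))%E} ->
  ((r * (1 - \prod_(i <- s) (1 - (k i)%:R^-1)))%:E <= u s)%E.
Proof.
elim/last_ind: s => [|s i IH] + r0.
  by move=> _ _; rewrite big_nil subrr mulr0; exact: expected_value_ge0.
rewrite rcons_uniq => /andP[is_ us] rs.
have {IH rs}[IH ri] : ((r * (1 - \prod_(i <- s) (1 - (k i)%:R^-1)))%:E <= u s)%E /\
    (r%:E <= replication_score g (@Y i))%E.
  split; last by apply: rs; rewrite mem_rcons mem_head.
  by apply: IH => // j js; apply: rs; rewrite mem_rcons inE js orbT.
have := replication_step g_value g_mono g_cont g_dr X_ge0 (@Y_ge0 i) X_indep
  (@Y_law i) (enum 'I_(k i)) is_.
rewrite size_enum_ord => step.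
have {}step : (r%:E + (k i)%:R%:E * u s <= u s + (k i)%:R%:E * u (rcons s i))%E.
  apply: le_trans step; apply: leeD => //.
  by move: ri; rewrite /replication_score unlock.
have le_si := expected_value_subseq (subseq_rcons s i).
move: IH le_si step (expected_value_ge0 s) (expected_value_ge0 (rcons s i)).
case: (u (rcons s i)) => [b||] //; last by move=> *; rewrite leey.
case: (u s) => [a||] //.
rewrite -!EFinM -!EFinD !lee_fin big_rcons /= => IH ab step a0 b0.
have k0 : (0 : R) < (k i)%:R by rewrite ltr0n.
have k1 : (1 : R) <= (k i)%:R by rewrite ler1n.
move: IH; set p := \prod_(j <- s) _ => IH.
(* After multiplication by [k i], the goal combines [step] with the induction hypothesis, weighted
   by [k i - 1 >= 0]. *)
rewrite -(ler_pM2l k0) [X in X <= _](_ : _ = r + (k i)%:R * (r * (1 - p)) - r * (1 - p)).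
  by nra.
field; exact: lt0r_neq0.
Qed.

(* The saturation level 23/10 nearly minimizes v + (61/36) v / (v - 1), whose
   minimum (1 + sqrt (61/36))^2 is below 5.307. *)
Lemma expected_value_saturated (s : seq 'I_n) (r : R) (y : seq R) :
    0 < r -> nonneg_vec y -> g y = 23 / 10 * r ->
    (forall x z, (size x <= m.-1)%N -> nonneg_vec x -> 0 <= z ->
      g x <= 23 / 10 * r -> g (rcons y z) - g y <= g (rcons x z) - g x) ->
    \sum_(i <- s) c i <= B ->
    {in s, forall i, (replication_score g (@Y i) <= r%:E)%E} ->
  (u s <= (q_const * r)%:E)%E.
Proof.
move=> r0 y0 gy yw cB rs.
pose D i t := g (rcons y (X i t)) - g y.
have D0 i t : 0 <= D i t by rewrite subr_ge0 value_rcons_ge.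
have mD i : measurable_fun setT (fun t => (D i t)%:E) by exact: measurable_gain.
apply: (@le_trans _ _ (\int[P]_t ((23 / 10 * r)%:E + \sum_(i <- s) (D i t)%:E))%E).
  apply: ge0_le_integral => //.
  - by move=> t _; rewrite lee_fin; apply/g_value.1/nonneg_vec_map.
  - exact: measurable_value_X.
  - by apply: emeasurable_funD => //; exact: emeasurable_sum.
  move=> t _; rewrite sumEFin -EFinD lee_fin.
  have nX : nonneg_vec [seq X i t | i <- s] by exact: nonneg_vec_map.
  have := value_cat_sub_le g_dr y0 nX.
  have : g [seq X i t | i <- s] <= g (y ++ [seq X i t | i <- s]).
    apply: g_mono; first exact: nonneg_vec_cat.
    exact/subvector_subseq/suffix_subseq.
  by rewrite big_map /D gy; lra.
have rr0 : 0 <= 23 / 10 * r by lra.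
rewrite ge0_integralD//; first last.
- exact: emeasurable_sum.
- by move=> t _; rewrite sume_ge0// => i _; rewrite lee_fin.
rewrite integral_cst// [X in (_ * X)%E](@probability_setT _ _ _ P) mule1.
rewrite ge0_integral_sum//; last by move=> i t _; rewrite lee_fin.
have gainE i : i \in s ->
    (\int[P]_t (D i t)%:E <= (r * (23 / 13) * (k i)%:R^-1)%:E)%E.
  move=> is_.
  have k0 : (0 : R) < (k i)%:R by rewrite ltr0n.
  have := @saturated_gain_le R g g_value g_mono g_cont _ T _ T' P P' _ (@Y i) (X i)
    (@Y_ge0 i) (X_ge0 i) (@Y_indep i) _ y (23 / 10 * r) r (enum 'I_(k i)) y0 _
    (enum_uniq _).
  rewrite size_enum_ord => H.
  have {H} : (((k i)%:R * (1 - r / (23 / 10 * r)))%:E * \int[P]_t (D i t)%:E <= r%:E)%E.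
    apply: H => [j E mE|||]; first by rewrite (Y_law j).
    - by apply/andP; split; lra.
    (* Fewer than [k i <= m] copies are present before a draw, hence at most [m - 1], the sizes
       covered by the hypothesis on [y]. *)
    - move=> x z xk; apply: yw.
      have m0 : (0 < m)%N := leq_trans (k_gt0 i) (le_km i).
      by rewrite -ltnS prednK// (leq_trans xk (le_km i)).
    - by have := rs i is_; rewrite /replication_score unlock.
  rewrite (_ : 1 - r / (23 / 10 * r) = 13 / 23); last first.
    by field; rewrite lt0r_neq0.
  have : (0 <= \int[P]_t (D i t)%:E)%E by apply: integral_ge0 => t _; rewrite lee_fin.
  case: (\int[P]_t (D i t)%:E)%E => [a||] //.
    rewrite -EFinM !lee_fin => a0 h.
    by rewrite ler_pdivlMr//; lra.
  (* An infinite gain would contradict the finite bound [r]. *)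
  by rewrite gt0_muley// lte_fin mulr_gt0.
apply: (@le_trans _ _ ((23 / 10 * r)%:E + \sum_(i <- s) (r * (23 / 13) * (k i)%:R^-1)%:E)%E).
  apply: leeD => //; rewrite big_seq [X in (_ <= X)%E]big_seq.
  exact: lee_sum.
rewrite sumEFin -EFinD lee_fin -mulr_sumr.
(* The weights are [c i / B], of total at most 1. *)
have : \sum_(i <- s) (k i)%:R^-1 <= (61 / 36 : R).
  apply: (@sum_inv_replications_le R _ (fun i => c i / B)) => [i|//|i|].
  - by case/andP: (c_bounds i) => ? ?; rewrite divr_gt0.
  - rewrite mulrA ltr_pdivlMr// mul1r.
    by case/andP: (replications_itv (c_bounds i)).
  - rewrite -mulr_suml; case: s cB {rs gainE} => [|i s] cB; first by rewrite big_nil mul0r.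
    by rewrite ler_pdivrMr ?mul1r.
(* Numerically, 23/10 + (23/13) (61/36) is about 5.298. *)
move: (\sum_(i <- s) _) => a ha; rewrite /q_const; nra.
Qed.

Lemma expected_value_upper (s : seq 'I_n) (r : R) : 0 < r -> g [::] <= r ->
    uniq s -> \sum_(i <- s) c i <= B ->
    {in s, forall i, (replication_score g (@Y i) <= r%:E)%E} ->
  (u s <= (q_const * r)%:E)%E.
Proof.
move=> r0 gr us cB rs; have v0 : 0 <= 23 / 10 * r by lra.
have pad (x : seq R) (l : nat) : nonneg_vec x -> g (x ++ nseq l 0) = g x.
  move=> x0; elim: l => [|l IH]; first by rewrite cats0.
  rewrite -IH -addn1 nseqD catA cats1 g_value.2//; apply: nonneg_vec_cat => // a.
  by rewrite mem_nseq => /andP[_ /eqP->].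
(* If the level is reached by a vector of size [m], it is attained exactly, since the zero vector
   has value [g [::] <= r] below it. Otherwise all values on such vectors are below it, and padding
   bounds the integrand. *)
have [[x [xm x0 vx]]|notv] := pselect (exists x,
    [/\ size x = m, nonneg_vec x & 23 / 10 * r <= g x]).
  have [y' [y'm y'0] gy'] : exists2 y, size y = size x /\ nonneg_vec y & g y = 23 / 10 * r.
    apply: (value_function_ivt g_cont) => //; rewrite vx andbT.
    by rewrite -[nseq _ _]cat0s pad//; lra.
  have [|y [ym y0 gy yw]] := g_edr.2 _ v0; first by exists y'; rewrite y'm xm.
  exact: (expected_value_saturated r0 y0).
apply: (@le_trans _ _ (\int[P]_t (23 / 10 * r)%:E)%E); last first.
  rewrite integral_cst// [X in (_ * X)%E](@probability_setT _ _ _ P) mule1.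
  by rewrite lee_fin /q_const; lra.
apply: ge0_le_integral => //.
- by move=> t _; rewrite lee_fin; apply/g_value.1/nonneg_vec_map.
- exact: measurable_value_X.
move=> t _; rewrite lee_fin leNgt; apply/negP => /ltW h; apply: notv.
have nX : nonneg_vec [seq X i t | i <- s] by exact: nonneg_vec_map.
exists ([seq X i t | i <- s] ++ nseq (m - size s) 0); split.
- rewrite size_cat size_map size_nseq subnKC// (leq_trans _ le_nm)//.
  by have := max_card (mem s); rewrite card_ord (card_uniqP us).
- by apply: nonneg_vec_cat => // a; rewrite mem_nseq => /andP[_ /eqP->].
- by rewrite pad.
Qed.

Lemma utility_perm (s : seq 'I_n) (S : {set 'I_n}) : uniq s -> s =i S ->
  utility g X S = u s.
Proof.
move=> us sS; rewrite /utility unlock; apply: eq_integral => t _.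
congr (_%:E); apply: g_sym; first exact: nonneg_vec_map.
apply: perm_map; apply: uniq_perm => //; first exact: enum_uniq.
by move=> i; rewrite mem_enum sS.
Qed.

Lemma utility_ge0 (S : {set 'I_n}) : (0 <= utility g X S)%E.
Proof.
rewrite (@utility_perm (enum S)) ?enum_uniq//; last by move=> i; rewrite mem_enum.
exact: expected_value_ge0.
Qed.

Lemma utility_subset (S1 S2 : {set 'I_n}) : S1 \subset S2 ->
  (utility g X S1 <= utility g X S2)%E.
Proof.
move=> /fintype.subsetP S12.
rewrite (@utility_perm [seq i <- enum S2 | i \in S1]); last 2 first.
- by rewrite filter_uniq// enum_uniq.
- by move=> i; rewrite mem_filter mem_enum andb_idr//; exact: S12.
rewrite (@utility_perm (enum S2)) ?enum_uniq//; last by move=> i; rewrite mem_enum.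
exact/expected_value_subseq/filter_subseq.
Qed.

Lemma utility_setU (S1 S2 : {set 'I_n}) :
  (utility g X (S1 :|: S2) <= utility g X S1 + utility g X S2)%E.
Proof.
(* Removing [S1] from [S2] makes the concatenated enumeration duplicate-free. *)
apply: (@le_trans _ _ (utility g X S1 + utility g X (S2 :\: S1))%E); last first.
  by rewrite leeD2l// utility_subset// finset.subsetDl.
rewrite (@utility_perm (enum S1 ++ enum (S2 :\: S1))); last 2 first.
- rewrite cat_uniq !enum_uniq /= andbT; apply/hasPn => i.
  by rewrite !mem_enum finset.inE => /andP[].
- by move=> i; rewrite mem_cat !mem_enum !finset.inE orb_andr orbN.
rewrite (@utility_perm (enum S1)) ?enum_uniq//; last by move=> i; rewrite mem_enum.
rewrite (@utility_perm (enum (S2 :\: S1))) ?enum_uniq//; last by move=> i; rewrite mem_enum.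
exact: expected_value_cat.
Qed.

Lemma sum_enum_cost (S : {set 'I_n}) : \sum_(i <- enum S) c i = cost c S.
Proof. by rewrite /cost big_enum. Qed.

(** Since [k i * c i <= B], the inverses [1 / k i] sum to at least [cost c S / B >= 1], so the
    product of the [1 - 1 / k i] is at most [1 / e]. *)
Lemma utility_lower (S : {set 'I_n}) (r : R) : B <= cost c S -> 0 <= r ->
    {in S, forall i, (r%:E <= replication_score g (@Y i))%E} ->
  ((p_const * r)%:E <= utility g X S)%E.
Proof.
move=> BS r0 rS.
rewrite (@utility_perm (enum S)) ?enum_uniq//; last by move=> i; rewrite mem_enum.
apply: (le_trans _ (@expected_value_lower (enum S) r (enum_uniq _) r0 _)); last first.
  by move=> i; rewrite mem_enum; exact: rS.
rewrite lee_fin mulrC ler_wpM2l// /p_const lerD2l lerN2.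
apply: (le_trans (prod_one_sub_le_expR _ _)) => [i|].
  by rewrite invf_le1 ?ler1n ?ltr0n.
rewrite div1r -expRN ler_expR lerN2.
rewrite -(@ler_pM2r _ B)// mul1r mulr_suml (le_trans BS)// -sum_enum_cost.
apply: ler_sum => i _; rewrite ler_pdivlMl ?ltr0n//.
by case/andP: (replications_itv (c_bounds i)).
Qed.

Lemma utility_upper (S : {set 'I_n}) (r : R) : g [::] <= r ->
    cost c S <= B ->
    {in S, forall i, (replication_score g (@Y i) <= r%:E)%E} ->
  (utility g X S <= (q_const * r)%:E)%E.
Proof.
move=> gr SB rS.
rewrite (@utility_perm (enum S)) ?enum_uniq//; last by move=> i; rewrite mem_enum.
have r0 : 0 <= r by apply: le_trans gr; exact: g_value.1.
(* The case [r = 0] is covered by a limit: the bound is applied at the positive level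
   [r + e / q_const], which costs exactly [e]. *)
apply/lee_addgt0Pr => e e0; rewrite -EFinD.
have q0 : 0 < q_const :> R by rewrite /q_const; lra.
have eq0 : 0 < e / q_const by rewrite divr_gt0.
have -> : q_const * r + e = q_const * (r + e / q_const).
  by rewrite mulrDr mulrCA divff ?mulr1// lt0r_neq0.
apply: expected_value_upper; rewrite ?enum_uniq ?sum_enum_cost//.
- by lra.
- by lra.
move=> i; rewrite mem_enum => /rS /le_trans; apply.
by rewrite lee_fin; lra.
Qed.

(** Supplies the condition [g [::] <= r] of [utility_upper] when [r] is the largest score outside
    the first items. *)
Lemma replication_score_ge (i : 'I_n) :
  ((g [::])%:E <= replication_score g (@Y i))%E.
Proof.
rewrite /replication_score unlock.
apply: (@le_trans _ _ (\int[P']_t (g [::])%:E)%E).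
  by rewrite integral_cst// [X in (_ * X)%E](@probability_setT _ _ _ P') mule1.
apply: ge0_le_integral => //.
- by move=> t _; rewrite lee_fin g_value.1.
- by apply/measurable_EFinP; exact: measurable_value_function.
move=> t _; rewrite lee_fin; apply: g_mono; first exact: nonneg_vec_map.
exact/subvector_subseq/sub0seq.
Qed.

End Items.

(** * Greedy sets and the approximation ratio *)

Lemma greedy_fill_subset {R : realType} {n : nat} (c : 'I_n -> R) (B : R)
    (S : {set 'I_n}) (l : seq 'I_n) : S \subset greedy_fill c B S l.
Proof.
elim: l S => [S|i l IH S] /=; first exact: subxx.
rewrite /greedy_fill /=; case: ifP => _; last exact: IH.
exact: fintype.subset_trans (finset.subsetU1 _ _) (IH _).
Qed.

Theorem theorem1 (R : realType) (n m : nat)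
  (g : seq R -> R)
  (g_value : value_function g)
  (g_sym : symmetric_vf g)
  (g_mono : monotone_vf g)
  (g_cont : continuous_vf g)
  (g_edr : extended_diminishing_returns m g)
  (B : R) (B_gt0 : 0 < B)
  (c : 'I_n -> R) (c_bounds : forall i, 0 < c i <= B)
  (le_nm : (n <= m)%N)
  (le_km : forall i, (replications B (c i) <= m)%N)
  (d : measure_display) (T : measurableType d) (P : probability T R)
  (X : 'I_n -> {RV P >-> R})
  (X_ge0 : forall i t, 0 <= X i t)
  (X_indep : independent_RVs X)
  (d' : measure_display) (T' : measurableType d') (P' : probability T' R)
  (Y : forall i : 'I_n, 'I_(replications B (c i)) -> {RV P' >-> R})
  (Y_ge0 : forall i j t, 0 <= Y i j t)
  (Y_law : forall i j, same_law (X i) (Y i j))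
  (Y_indep : forall i, independent_RVs (Y i))
  (rhat : 'I_n -> R) (eps : R) (eps_bounds : 0 <= eps < 1)
  (s : {perm 'I_n}) (s_sort : sorting_relabelling rhat s)
  (k : 'I_n) (k_break : is_break_index c B s k)
  (acc : eps_accurate (fun i => replication_score g (Y i)) eps s k)
  (A : {set 'I_n}) (A_out : alg1_output c B (utility g X) s k A)
  (OPT : {set 'I_n}) (OPT_opt : is_optimal c B (utility g X) OPT) :
  ((((1 - eps) * p_const) / ((1 - eps) * p_const + 2 * q_const))%:E
     * utility g X OPT <= utility g X A)%E.
Proof.
have [g_dr _] := g_edr.
set u := utility g X; pose r i := replication_score g (Y i).
set M := (\big[maxe/-oo]_(l < n | (k <= l)%N) r (s l))%E.
set K := [set s j | j : 'I_n & (j < k)%N]%SET.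
have uA : (u (S_star c B s k) <= u A)%E /\ (u (S_starstar c B s k) <= u A)%E.
  by case: A_out => -[-> ?].
have uK : (u K <= u A)%E.
  by apply: le_trans uA.1; apply: utility_subset => //; exact: greedy_fill_subset.
have uK1 : (u (K :|: [set s k])%SET <= u A + u A)%E.
  apply: (le_trans (utility_setU g_value g_sym g_mono g_cont g_dr X_ge0 _ _)).
  apply: leeD => //; apply: le_trans uA.2; apply: utility_subset => //.
  exact: greedy_fill_subset.
have inK1 j : (s j \in K :|: [set s k])%SET = (j <= k)%N.
  rewrite finset.in_setU finset.in_set1 (inj_eq perm_inj) mem_imset; last exact: perm_inj.
  by rewrite finset.inE [RHS]leq_eqVlt orbC.
have costK1 : B <= cost c (K :|: [set s k])%SET.
  case: k_break => _ /andP[_ /ltW /le_trans]; apply.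
  by rewrite /cost [X in _ <= X](reindex_inj (@perm_inj _ s)) /= (eq_bigl _ _ inK1).
(* The level [r0] is left free because [M] may be infinite. *)
have lower (r0 : R) : 0 <= r0 -> (forall j : 'I_n, (j <= k)%N -> (r0%:E <= r (s j))%E) ->
    ((p_const * r0)%:E <= u A + u A)%E.
  move=> r00 rr0; apply: le_trans uK1.
  apply: (utility_lower g_value g_sym g_mono g_cont g_dr B_gt0 c_bounds X_ge0 X_indep
    Y_ge0 Y_law) => //.
  by move=> i; rewrite -(permKV s i) inK1; exact: rr0.
have p_gt0 : 0 < p_const :> R.
  by rewrite /p_const subr_gt0 ltr_pdivrMr ?expR_gt0// mul1r expR_gt1.
have eps1 : 0 < 1 - eps by case/andP: eps_bounds => _; rewrite subr_gt0.
have Mge (l : 'I_n) : (k <= l)%N -> (r (s l) <= M)%E.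
  by move=> kl; rewrite /M (bigD1 l)//= le_max lexx.
have gM : ((g [::])%:E <= M)%E.
  apply: le_trans (Mge k (leqnn _)); exact: replication_score_ge.
have g0 : 0 <= g [::] by exact: g_value.1.
have : (0 <= u A)%E by exact: utility_ge0.
move: uK uK1 lower; case EA : (u A) => [a||] // uK _ lower a0; last by rewrite leey.
rewrite lee_fin in a0.
have accE (j : 'I_n) : (j <= k)%N -> ((1 - eps)%:E * M <= r (s j))%E by exact: acc.
move: gM Mge accE; case: M => [x||] // gM Mge accE; last first.
  (* If [M] were infinite, all scores up to label [k] would be too, and this level would give
     [a + a + 1 <= a + a]. *)
  have w0 : 0 <= (a + a + 1) / p_const by rewrite divr_ge0 ?(ltW p_gt0)// !addr_ge0.
  have := lower _ w0; rewrite [p_const * _]mulrC divfK ?lt0r_neq0//.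
  rewrite -EFinD lee_fin => H; exfalso.
  suff : a + a + 1 <= a + a by rewrite gerDl ler10.
  apply: H => j jk; apply: le_trans (accE j jk).
  by rewrite gt0_muley ?lte_fin// leey.
rewrite lee_fin in gM.
have x0 : 0 <= x by exact: le_trans gM.
have {}lower : p_const * ((1 - eps) * x) <= a + a.
  rewrite -lee_fin EFinD; apply: lower => [|j jk]; first by rewrite mulr_ge0// ltW.
  by rewrite EFinM; exact: accE.
(* [OPT :&: K] is bounded by [u K <= u A], and items of [OPT :\: K] have score at most [M], now the
   real [x]. *)
have upper : (u OPT <= (a + q_const * x)%:E)%E.
  rewrite -(finset.setID OPT K) EFinD.
  apply: (le_trans (utility_setU g_value g_sym g_mono g_cont g_dr X_ge0 _ _)).
  apply: leeD.
    apply: le_trans uK; apply: utility_subset => //; exact: finset.subsetIr.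
  apply: (utility_upper g_value g_sym g_mono g_cont g_dr g_edr B_gt0 c_bounds
    le_nm le_km X_ge0 Y_ge0 Y_law Y_indep) => //.
    apply: le_trans OPT_opt.1; rewrite /cost [X in _ <= X](big_setID K) /= lerDr.
    by apply: sumr_ge0 => i _; case/andP: (c_bounds i) => /ltW.
  move=> i; rewrite -(permKV s i) finset.inE => /andP[+ _].
  rewrite mem_imset; last exact: perm_inj.
  by rewrite finset.inE -leqNgt => /Mge.
move: upper (utility_ge0 g_value g_sym X_ge0 OPT); rewrite -/u.
case: (u OPT) => [z||] //; rewrite -EFinM !lee_fin => upper z0.
set p := (1 - eps) * p_const.
have p0 : 0 < p by rewrite mulr_gt0.
have q0 : 0 < q_const :> R by rewrite /q_const; lra.
rewrite mulrAC ler_pdivrMr; last by nra.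
have {}lower : p * x <= a + a by rewrite /p [(1 - eps) * _]mulrC -mulrA.
(* From [p * x <= 2 a] one gets [p * (a + q x) <= (p + 2 q) * a]. *)
apply: (@le_trans _ _ (p * (a + q_const * x))); first by rewrite ler_pM2l.
by nra.
Qed.
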